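(* For every non-negative integer $L$, \[ \sum_{j=-L}^{L}\left(\frac{j+1}{3}\right)q^{j(j+1)}{2L\brack L-j}_q=\sum_{j=-L-1}^{L+1}\left(\frac{j+1}{3}\right)q^{j(j+1)}{2L+1\brack L-j}_q. \]
   Context: $(a;q)_n=\prod_{k=0}^{n-1}(1-aq^k)$. The $q$-binomial coefficient is ${m+n\brack m}_q=\frac{(q;q)_{m+n}}{(q;q)_m(q;q)_n}$ for $m,n\ge 0$ and $0$ otherwise. $\left(\frac{a}{3}\right)$ denotes the Jacobi symbol modulo 3: $0$ if $3\mid a$, $1$ if $a\equiv1\pmod 3$, $-1$ if $a\equiv 2\pmod 3$. *)

(* Defs.v *)
From HB Require Import structures.
From mathcomp Require Import all_boot all_order all_algebra.

Set Implicit Arguments.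
Unset Strict Implicit.
Unset Printing Implicit Defensive.

Import GRing.Theory Num.Theory.
Local Open Scope ring_scope.

(* (a;q)_n *)
Definition qpoch (F : fieldType) (a q : F) (n : nat) : F :=
  \prod_(k < n) (1 - a * q ^+ k).

(* [N, m]_q; the top index N = m + n is given and n is recovered as N - m. *)
Definition qbinom (F : fieldType) (q : F) (N m : int) : F :=
  if (0 <= m) && (0 <= N - m) then
    qpoch q q `|N|%N / (qpoch q q `|m|%N * qpoch q q `|N - m|%N)
  else 0.

(* The Jacobi symbol (a/3); [modz] takes values in {0, 1, 2}, also for a < 0. *)
Definition jacobi3 (a : int) : int :=
  if (a %% 3)%Z == 0 then 0 else if (a %% 3)%Z == 1 then 1 else -1.

(* The integers a, a + 1, ..., b, empty when b < a. *)
Definition zrange (a b : int) : seq int :=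
  if a <= b then [seq a + i%:Z | i <- iota 0 `|b - a|%N.+1] else [::].

(* Main.v *)
(** The q-Pascal rule splits the right-hand binomial [2L+1, L-j] as
    [2L, L-j] + q^(L+j+1) [2L, L-j-1].  The first part reproduces the left-hand
    side.  In the second, the exponent j(j+1) + L+j+1 equals L + (j+1)^2, so with
    k = j + 1 it becomes q^L times the sum of (k/3) q^(k^2) [2L, L-k], which
    vanishes because its terms are odd in k. *)
Require Import Defs.
From HB Require Import structures.
From mathcomp Require Import all_boot all_order all_algebra.
From mathcomp Require Import zify ring.

Import Order.TTheory GRing.Theory Num.Theory.
Local Open Scope ring_scope.

Lemma qpochS (F : fieldType) (a q : F) n :
  qpoch a q n.+1 = qpoch a q n * (1 - a * q ^+ n).
Proof. by rewrite /qpoch big_ord_recr. Qed.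

Lemma qpoch0 (F : fieldType) (a q : F) : qpoch a q 0 = 1.
Proof. by rewrite /qpoch big_ord0. Qed.

Lemma qpoch_neq0 (F : fieldType) (q : F) n :
  (forall k : nat, (0 < k)%N -> q ^+ k <> 1) -> qpoch q q n != 0.
Proof.
move=> hq; apply/prodf_neq0 => k _.
by rewrite -exprS subr_eq0 eq_sym; apply/eqP/hq.
Qed.

Lemma qbinom_small (F : fieldType) (q : F) (N m : int) :
  m < 0 -> qbinom q N m = 0.
Proof. by rewrite /qbinom ltNge => /negPf ->. Qed.

Lemma qbinom_large (F : fieldType) (q : F) (N m : int) :
  N < m -> qbinom q N m = 0.
Proof.
by move=> ltNm; rewrite /qbinom subr_ge0 [m <= N]leNgt ltNm andbF.
Qed.

Lemma qbinom_nat (F : fieldType) (q : F) (a b : nat) :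
  qbinom q (a%:Z + b%:Z) a%:Z
  = qpoch q q (a + b)%N / (qpoch q q a * qpoch q q b).
Proof. by rewrite /qbinom addrAC subrr add0r. Qed.

Lemma qbinom_sym (F : fieldType) (q : F) (N m : int) :
  qbinom q N (N - m) = qbinom q N m.
Proof.
by rewrite /qbinom opprB addrCA subrr addr0 andbC [qpoch _ _ `|N - m| * _]mulrC.
Qed.

(** Away from the boundary, dividing by the common factors leaves
    [1 - x * y = (1 - y) + y * (1 - x)], where [x] and [y] are the powers of [q] in the last factors
    of the two denominator products. The hypothesis on [q] makes every denominator nonzero. *)
Lemma qbinom_pascal (F : fieldType) (q : F) (N : nat) (m : int) :
  (forall k : nat, (0 < k)%N -> q ^+ k <> 1) ->
  qbinom q (N%:Z + 1) m
  = qbinom q N%:Z m + q ^ (N%:Z + 1 - m) * qbinom q N%:Z (m - 1).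
Proof.
move=> hq; have nz n : qpoch q q n != 0 by apply: qpoch_neq0.
have [m_lt0|m_ge0] := ltP m 0.
  by rewrite !qbinom_small ?mulr0 ?addr0 //; lia.
have [m_gtN|m_leN] := ltP (N%:Z + 1) m.
  by rewrite !qbinom_large ?mulr0 ?addr0 //; lia.
have [->|m_neq0] := eqVneq m 0.
  rewrite (qbinom_small _ _ _ (0 - 1)) // mulr0 addr0.
  have qbinom0 n : qbinom q n%:Z 0 = 1.
    by have := qbinom_nat F q 0 n; rewrite add0r add0n qpoch0 mul1r divff.
  by rewrite qbinom0 -[N%:Z + 1]/(N%:Z + 1%:Z) -PoszD qbinom0.
have [->|m_neqN] := eqVneq m (N%:Z + 1).
  rewrite subrr expr0z mul1r addrK (qbinom_large _ _ N%:Z) ?add0r; last by lia.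
  have qbinomnn n : qbinom q n%:Z n%:Z = 1.
    by have := qbinom_nat F q n 0; rewrite addr0 addn0 qpoch0 mulr1 divff.
  by rewrite qbinomnn -[N%:Z + 1]/(N%:Z + 1%:Z) -PoszD qbinomnn.
have [a [b [-> ->]]] : exists a b : nat, m = a.+1%:Z /\ N = (a + b).+1.
  by exists `|m - 1|%N, `|N%:Z - m|%N; lia.
have -> : (a + b).+1%:Z + 1 - a.+1%:Z = b.+1%:Z by lia.
have -> : a.+1%:Z - 1 = a%:Z by lia.
have -> : (a + b).+1%:Z + 1 = a.+1%:Z + b.+1%:Z by lia.
(* The same top index is split in two different ways, so that [qbinom_nat] applies to each binomial
   on the right. *)
have {2}-> : (a + b).+1%:Z = a%:Z + b.+1%:Z by lia.
have -> : (a + b).+1%:Z = a.+1%:Z + b%:Z by lia.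
rewrite !qbinom_nat -exprnP !addnS !addSn (qpochS _ _ _ (a + b).+1).
rewrite (qpochS _ _ _ a) (qpochS _ _ _ b) -!exprS.
have -> : q ^+ (a + b).+2 = q ^+ a.+1 * q ^+ b.+1 by rewrite -exprD addnS addSn.
have nz1 n : 1 - q ^+ n.+1 != 0 by rewrite subr_eq0 eq_sym; apply/eqP/hq.
move: (nz1 a) (nz1 b); move: (q ^+ a.+1) (q ^+ b.+1) => x y nzx nzy.
by field; rewrite !nz nzx nzy.
Qed.

Lemma jacobi3N (a : int) : jacobi3 (- a) = - jacobi3 a.
Proof.
rewrite /jacobi3; have [r [k [-> hr]]] : exists r k : int,
   a = k * 3 + r /\ (r = 0 \/ r = 1 \/ r = 2).
  by exists (a %% 3)%Z, (a %/ 3)%Z; lia.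
by rewrite opprD -mulNr !modzMDl; case: hr => [->|[->|->]].
Qed.

Lemma sum_zrange_sym0 (F : fieldType) (f : int -> F) :
  \sum_(j <- zrange (- 0%:Z) 0%:Z) f j = f 0.
Proof. by rewrite oppr0 /zrange /= big_seq1. Qed.

Lemma sum_zrange (F : fieldType) (f : int -> F) (a : int) (n : nat) :
  \sum_(j <- zrange a (a + n%:Z)) f j = \sum_(i < n.+1) f (a + i%:Z).
Proof.
rewrite /zrange lerDl le0z_nat (_ : absz (a + n%:Z - a)%R = n); last by lia.
rewrite big_map.
by rewrite -/(index_iota 0 n.+1) big_mkord.
Qed.

Lemma sum_zrange_symS (F : fieldType) (f : int -> F) (L : nat) :
  \sum_(j <- zrange (- L%:Z - 1) (L%:Z + 1)) f j
  = f (- L%:Z - 1) + \sum_(j <- zrange (- L%:Z) L%:Z) f j + f (L%:Z + 1).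
Proof.
have -> : L%:Z + 1 = - L%:Z - 1 + (L.*2.+2)%:Z by lia.
have -> : zrange (- L%:Z) L%:Z = zrange (- L%:Z) (- L%:Z + (L.*2)%:Z).
  by congr zrange; lia.
rewrite !sum_zrange big_ord_recr big_ord_recl /= addr0; congr (_ + _ + _).
by apply: eq_bigr => i _; congr f; rewrite /bump /=; lia.
Qed.

(** Induction peels off the two end terms, which cancel. The value at [0] is a separate hypothesis
    because oddness does not force it in characteristic 2. *)
Lemma sum_zrange_odd (F : fieldType) (f : int -> F) (L : nat) :
  f 0 = 0 -> (forall k, f (- k) = - f k) ->
  \sum_(j <- zrange (- L%:Z) L%:Z) f j = 0.
Proof.
move=> f0 fN; elim: L => [|L IHL]; first by rewrite sum_zrange_sym0.
have -> : - L.+1%:Z = - L%:Z - 1 by lia.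
have -> : L.+1%:Z = L%:Z + 1 by lia.
by rewrite sum_zrange_symS IHL addr0 -opprD fN addNr.
Qed.

Theorem theorem11 (F : fieldType) (q : F)
    (hq : forall k : nat, (0 < k)%N -> q ^+ k <> 1) (L : nat) :
  \sum_(j <- zrange (- L%:Z) L%:Z)
     (jacobi3 (j + 1))%:~R * q ^ (j * (j + 1)) * qbinom q (2 * L%:Z) (L%:Z - j)
  = \sum_(j <- zrange (- L%:Z - 1) (L%:Z + 1))
     (jacobi3 (j + 1))%:~R * q ^ (j * (j + 1))
       * qbinom q (2 * L%:Z + 1) (L%:Z - j).
Proof.
pose h k := (jacobi3 k)%:~R * q ^ (k * k) * qbinom q (2 * L%:Z) (L%:Z - k).
have split_term (j : int) : (jacobi3 (j + 1))%:~R * q ^ (j * (j + 1))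
      * qbinom q (2 * L%:Z + 1) (L%:Z - j)
    = (jacobi3 (j + 1))%:~R * q ^ (j * (j + 1))
        * qbinom q (2 * L%:Z) (L%:Z - j) + q ^+ L * h (j + 1).
  have e2L : 2 * L%:Z = (2 * L)%N%:Z by [].
  rewrite /h e2L qbinom_pascal // mulrDr; congr (_ + _).
  have -> : L%:Z - (j + 1) = L%:Z - j - 1 by lia.
  (* Since [q = 0] is allowed, exponents are added only once they are known to be non-negative. For
     [j < - L - 1] the exponent [L + j + 1] is negative, but then the lower index [L - j - 1]
     exceeds [2 * L] and both sides vanish. *)
  have [j_small|j_ge] := ltP j (- L%:Z - 1).
    by rewrite qbinom_large ?mulr0 //; lia.
  rewrite !mulrA; congr (_ * _); rewrite -mulrA [RHS]mulrAC mulrC.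
  congr (_ * _).
  have [a ha] : exists a : nat, j * (j + 1) = a%:Z.
    by exists `|(j * (j + 1))%R|%N; nia.
  have [b hb] : exists b : nat, (2 * L)%N%:Z + 1 - (L%:Z - j) = b%:Z.
    by exists `|(L%:Z + j + 1)%R|%N; lia.
  have [c hc] : exists c : nat, (j + 1) * (j + 1) = c%:Z.
    by exists `|((j + 1) * (j + 1))%R|%N; nia.
  rewrite ha hb hc -!exprnP -!exprD; congr (_ ^+ _); nia.
have sum_h : \sum_(j <- zrange (- L%:Z - 1) (L%:Z + 1)) h (j + 1) = 0.
  (* Here [k = j + 1] runs from [- L] to [L + 2]; the last two terms have lower index [-1] and [-2],
     so they vanish and a symmetric range remains. *)
  have -> : L%:Z + 1 = - L%:Z - 1 + (L.*2.+2)%:Z by lia.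
  rewrite sum_zrange 2!big_ord_recr /= {2 3}/h.
  rewrite !qbinom_small ?mulr0 ?addr0; try lia.
  transitivity (\sum_(j <- zrange (- L%:Z) L%:Z) h j); last first.
    apply: sum_zrange_odd => [|k]; first by rewrite /h mul0r mul0r.
    (* The binomial is even in [k] because [L + k = 2 * L - (L - k)], so the sign comes from the
       Jacobi symbol alone. *)
    rewrite /h jacobi3N mulrNN rmorphN !mulNr -[in RHS]qbinom_sym.
    by congr (- (_ * qbinom _ _ _)); lia.
  have -> : zrange (- L%:Z) L%:Z = zrange (- L%:Z) (- L%:Z + (L.*2)%:Z).
    by congr zrange; lia.
  by rewrite sum_zrange; apply: eq_bigr => i _; congr h; lia.
under [RHS]eq_bigr do rewrite split_term.
rewrite big_split /= -mulr_sumr sum_h mulr0 addr0 sum_zrange_symS.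
(* The extra terms [j = - L - 1] and [j = L + 1] have lower indices [2 * L + 1] and [-1], both out
   of range for top index [2 * L]. *)
rewrite [X in _ = X + _ + _](_ : _ = 0); last first.
  by rewrite qbinom_large ?mulr0 //; lia.
rewrite [X in _ = _ + X](_ : _ = 0); last by rewrite qbinom_small ?mulr0 //; lia.
by rewrite add0r addr0.
Qed.
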